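(* Let $r\geq 2$, $k\ge 2$, $1\leq \ell\leq k-1$, and set $q := \ell-1+\lfloor\frac{k}{k-\ell}\rfloor(k-\ell)$ and $c_0:=c_0(r,k,\ell)=2k^2\,\hat{R}_r(P_{q}^{(k-1,\ell-1)})$. For all $n\geq c_0$, \[ \hat{R}_r(P_{n}^{(k,\ell)})\geq \frac1{k}\, \hat{R}_r(P_{q}^{(k-1,\ell-1)})\, R_r(P_{n-c_0}^{(k,\ell)}). \] In particular, if $\ell=k-1$, then $\hat{R}_r(P^{(k)}_{n})\geq \frac1{k}\, \hat{R}_r(P_{2k-2}^{(k-1)})\, R_r(P_{n-c_0}^{(k)})$.
   Context: A $k$-graph is a $k$-uniform hypergraph. For hypergraphs $G,H$ and an integer $r\ge 1$, $G\to_r H$ means that every $r$-coloring of the edges of $G$ contains a monochromatic copy of $H$. For a $k$-graph $H$, the $r$-color size-Ramsey number $\hat R_r(H)$ is the minimum number of edges of a $k$-graph $G$ with $G\to_r H$, and the $r$-color Ramsey number $R_r(H)$ is the minimum number of vertices of a $k$-graph $G$ with $G\to_r H$. For $0\le \ell\le k-1$ and $m\ge 1$, the $k$-uniform $\ell$-overlapping path (or $(k,\ell)$-path) with $m$ edges is the $k$-graph with vertex set $\{v_1,\dots,v_{k+(m-1)(k-\ell)}\}$ and edges $\{v_{(i-1)(k-\ell)+1},\dots,v_{(i-1)(k-\ell)+k}\}$ for $i\in[m]$; $P_n^{(k,\ell)}$ denotes the $(k,\ell)$-path with $n$ vertices (so it has $(n-\ell)/(k-\ell)$ edges). For $\ell=0$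 this is a $k$-uniform matching. $P_n^{(k)}:=P_n^{(k,k-1)}$ is the $k$-uniform tight path on $n$ vertices. *)

(* Defs.v *)
From mathcomp Require Import all_boot all_order all_algebra.
From mathcomp Require Import boolp.

Set Implicit Arguments.
Unset Strict Implicit.
Unset Printing Implicit Defensive.

(* Finite k-uniform hypergraphs; isolated vertices are allowed. *)
Record kgraph (k : nat) := KGraph {
  vert :> finType;
  edges : {set {set vert}};
  edges_card : forall e, e \in edges -> #|e| = k }.

(* The colouring is a total function on vertex subsets, but only its values on
   the edges of G matter. A copy of H is a not necessarily induced one. *)
Definition arrows (r k : nat) (G H : kgraph k) : Prop :=
  forall col : {set G} -> 'I_r,
  exists (c : 'I_r) (f : H -> G), injective f /\
    forall e, e \in edges H -> f @: e \in edges G /\ col (f @: e) = c.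

(* The minimum of a set of natural numbers, with value 0 on the empty set. The
   sets of [size_ramsey] and [ramsey] below are nonempty for r >= 1, by Ramsey's
   theorem for uniform hypergraphs. *)
Definition least (P : nat -> Prop) : nat :=
  if pselect (exists n, `[< P n >]) is left exP then ex_minn exP else 0.

Lemma leastP (P : nat -> Prop) (n : nat) :
  P n -> P (least P) /\ forall m, P m -> least P <= m.
Proof.
move=> Pn; rewrite /least; case: pselect => [exP|[]]; last by exists n; apply/asboolP.
by case: ex_minnP => m /asboolP Pm min_m; split=> // p /asboolP /min_m.
Qed.

Definition size_ramsey (r k : nat) (H : kgraph k) : nat :=
  least (fun m => exists G : kgraph k, arrows r G H /\ #|edges G| = m).

Definition ramsey (r k : nat) (H : kgraph k) : nat :=
  least (fun m => exists G : kgraph k, arrows r G H /\ #|G| = m).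

Section OverlappingPath.
Variables k l n : nat.

Definition path_edge (i : nat) : {set 'I_n} :=
  [set v : 'I_n | i * (k - l) <= v < i * (k - l) + k].

Definition path_edges : {set {set 'I_n}} :=
  [set path_edge i | i : 'I_((n - l) %/ (k - l))].

Lemma path_edges_card e : e \in path_edges -> #|e| = k.
Proof.
case/imsetP=> -[i /= lt_i] _ ->; rewrite /path_edge.
have d_gt0 : 0 < k - l by case: (k - l) lt_i.
have le_n : i * (k - l) + k <= n.
  move: lt_i; rewrite -[_ < _]/(i.+1 <= _) leq_divRL // mulSn => le1.
  have lt_ln : l < n.
    by rewrite -subn_gt0; apply: leq_trans le1; rewrite addn_gt0 d_gt0.
  have lt_lk : l < k by rewrite -subn_gt0.
  move: le1; rewrite leq_subRL ?(ltnW lt_ln) //.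
  by rewrite addnA subnKC ?(ltnW lt_lk) // addnC.
have lt_s (j : 'I_k) : i * (k - l) + j < n.
  by apply: leq_trans le_n; rewrite ltn_add2l.
pose s j := Ordinal (lt_s j).
have inj_s : injective s by move=> a b [] /addnI /val_inj.
suff -> : [set v : 'I_n | i * (k - l) <= v < i * (k - l) + k] = s @: 'I_k.
  by rewrite card_imset // card_ord.
apply/setP=> v; rewrite inE; apply/andP/imsetP => [[le1 lt2]|[j _ ->]].
  have lt_vk : v - i * (k - l) < k by rewrite ltn_subLR.
  by exists (Ordinal lt_vk) => //; apply: val_inj; rewrite /= subnKC.
by rewrite /= leq_addr ltn_add2l.
Qed.

(* P_n^(k,l), with v_1, ..., v_n numbered from 0. If n = k + (m - 1)(k - l) then
   (n - l) %/ (k - l) = m. For other values of n, including n < k, this is the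
   longest (k,l)-path that fits into n vertices, followed by isolated vertices;
   it always has exactly n vertices. *)
Definition opath : kgraph k := KGraph path_edges_card.

End OverlappingPath.

Definition tight_path (k n : nat) : kgraph k := opath k (k - 1) n.

Definition link_order (k l : nat) : nat := l - 1 + k %/ (k - l) * (k - l).

Definition c0 (r k l : nat) : nat :=
  2 * k ^ 2 * size_ramsey r (opath (k - 1) (l - 1) (link_order k l)).

(* Main.v *)
Require Import Defs.
From mathcomp Require Import all_boot all_order all_algebra.
From mathcomp Require Import boolp zify.
Import Order.TTheory GRing.Theory Num.Theory.

(** Let [s] be the size-Ramsey number of [P_q^(k-1,l-1)], and let [G] arrow
    [P_n^(k,l)] with as few edges as possible. Call a vertex low if its degree
    is less than [s]. It is enough to find at least [R_r(P_(n-c0))] vertices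
    that are not low, since the degrees sum to [k * #|edges G|]. If there are
    fewer, colour the edges without low vertices so as to avoid [P_(n-c0)].
    The link of a low vertex has fewer than [s] edges, so it has a colouring
    without a monochromatic [P_q]. Split the low vertices into at most
    [s * (k - 1)] classes so that no edge meets a class twice, and colour each
    remaining edge according to the link colouring of its low vertex of
    smallest class. On a monochromatic path, low vertices then only occur
    within [s * (k - 1) ^ 2] of the ends, and the rest of the path contains
    [P_(n-c0)], a contradiction. *)

(** * Ramsey's theorem for uniform hypergraphs *)

Definition complete_edges k (T : finType) : {set {set T}} :=
  [set e : {set T} | #|e| == k].

Lemma complete_edges_card k (T : finType) (e : {set T}) :
  e \in complete_edges k T -> #|e| = k.
Proof. by rewrite inE => /eqP. Qed.

Definition complete k (T : finType) : kgraph k :=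
  KGraph (complete_edges_card k T).

Lemma ramsey_sets (C : finType) k n :
  exists N, forall (T : finType) (S : {set T}) (col : {set T} -> C),
    N <= #|S| -> exists c (A : {set T}), [/\ A \subset S, #|A| = n &
      forall e : {set T}, e \subset A -> #|e| = k -> col e = c].
Proof.
elim: k n => [|k IHk] n.
  exists n => T S col leS; exists (col set0).
  exists [set x in take n (enum S)]; split.
  - by apply/subsetP => x; rewrite inE => /mem_take; rewrite mem_enum.
  - have /card_uniqP U : uniq (take n (enum S)) by rewrite take_uniq ?enum_uniq.
    by rewrite cardsE U size_take -cardE; case: ltngtP leS.
  - by move=> e _ /eqP; rewrite cards_eq0 => /eqP ->.
(* Induction on the sum of the sizes [f c] wanted for the colours [c]: the
   common colour of the edges joining a vertex [x] to a large set, found by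
   the case [k], is the one whose size drops. *)
suff H m (f : C -> nat) : \sum_c f c <= m ->
    exists N, forall (T : finType) (S : {set T}) (col : {set T} -> C),
    N <= #|S| -> exists c (A : {set T}), [/\ A \subset S, #|A| = f c &
      forall e : {set T}, e \subset A -> #|e| = k.+1 -> col e = c].
  exact: (H _ (fun=> n) (leqnn _)).
elim: m f => [|m IHm] f le_m; case: (boolP [exists c, f c == 0]) => [/existsP[c0 /eqP fc0]|].
- exists 0 => T S col _; exists c0, set0; rewrite sub0set cards0 fc0; split=> // e.
  by rewrite subset0 => /eqP ->; rewrite cards0.
(* The sum bound 0 forces every wanted size to be 0. [C] might be empty, so the colour refuting
   [no0] has to come from [col]. *)
- move=> no0; exists 0 => T S col _; case/existsP: no0; exists (col set0).
  by move: le_m; rewrite leqn0 (bigD1 (col set0)) //= addn_eq0 => /andP[].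
- exists 0 => T S col _; exists c0, set0; rewrite sub0set cards0 fc0; split=> // e.
  by rewrite subset0 => /eqP ->; rewrite cards0.
rewrite negb_exists => /forallP f_gt0.
pose g c c' := f c' - (c' == c).
have le_g c : \sum_c' g c c' <= m.
  rewrite -ltnS; apply: leq_trans le_m.
  rewrite (bigD1 c) //= [X in _ < X](bigD1 c) //= /g eqxx.
  rewrite (eq_bigr f) => [|c' /negPf ->]; last by rewrite subn0.
  by have := f_gt0 c; case: (f c) => //= p _; rewrite subn1.
have [N0 HN0] := choice (fun c => IHm (g c) (le_g c)).
(* The maximum makes [A] large enough for the induction on [m], whichever colour [c] the edges
   through [x] receive. *)
have [N HN] := IHk (\max_c N0 c).
exists N.+1 => T S col leS.
have /card_gt0P[x xS] : 0 < #|S| by apply: leq_trans leS.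
have leSx : N <= #|S :\ x| by rewrite (cardsD1 x) xS in leS.
have [c [A [sAS cA colA]]] := HN T _ (fun e => col (x |: e)) leSx.
have leA : N0 c <= #|A| by rewrite cA leq_bigmax.
have [c' [B [sBA cB colB]]] := HN0 c T A col leA.
have sAS' := subset_trans sAS (subD1set S x).
(* If [c'] is [c], adding [x] to [B] makes up for the vertex that [g] took off; otherwise [B] has
   the wanted size already. *)
exists c'; case: (eqVneq c' c) cB => [ec|nc]; rewrite /g; last first.
  rewrite (negPf nc) subn0 => cB.
  by exists B; split=> //; apply: subset_trans sAS'.
rewrite ec eqxx => cB; exists (x |: B).
have xA : x \notin A.
  by apply/negP => /(subsetP sAS); rewrite !inE eqxx.
have xB : x \notin B by apply: contra xA; apply: (subsetP sBA).
split.
- by rewrite subUset sub1set xS (subset_trans sBA).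
- rewrite cardsU1 xB cB; have := f_gt0 c; lia.
move=> e sub_e ce; case: (boolP (x \in e)) => xe.
  have := colA (e :\ x); rewrite setD1K //; apply.
    apply: subset_trans sBA; rewrite subDset; exact: sub_e.
  by move: ce; rewrite (cardsD1 x) xe; case.
rewrite -ec; apply: colB => //; apply/subsetP => y ye.
by have := subsetP sub_e y ye; rewrite !inE => /predU1P[yx|//]; rewrite -yx ye in xe.
Qed.

Lemma exists_arrows r k (H : kgraph k) :
  exists G : kgraph k, arrows r G H.
Proof.
have [N HN] := ramsey_sets 'I_r k #|H|.
exists (complete k 'I_N) => col.
have [|c [A [_ cA colA]]] := HN _ [set: 'I_N] col; first by rewrite cardsT card_ord.
have lt_rank (x : H) : enum_rank x < #|A| by rewrite cA.
pose f (x : H) : 'I_N := enum_val (Ordinal (lt_rank x)).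
have inj_f : injective f.
  by move=> x y /enum_val_inj /(congr1 val) /= /val_inj /enum_rank_inj.
exists c, f; split=> // e He.
have cf : #|f @: e| = k by rewrite card_imset // edges_card.
split; first by rewrite inE; apply/eqP.
by apply: colA => //; apply/subsetP => y /imsetP[x _ ->]; apply: enum_valP.
Qed.

(** * Extremal hypergraphs and colourings avoiding a path *)

Lemma size_ramseyP r k (H : kgraph k) :
  exists2 G : kgraph k, arrows r G H & #|edges G| = size_ramsey r H.
Proof.
have [G aG] := exists_arrows r k H.
have [[G' [aG' cG']] _] := leastP
  (P := fun m => exists G : kgraph k, arrows r G H /\ #|edges G| = m)
  (ex_intro _ G (conj aG erefl)).
by exists G'.
Qed.

Lemma size_ramsey_le {r k} {G H : kgraph k} :
  arrows r G H -> size_ramsey r H <= #|edges G|.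
Proof.
move=> aG; have [_] := leastP
  (P := fun m => exists G : kgraph k, arrows r G H /\ #|edges G| = m)
  (ex_intro _ G (conj aG erefl)).
by apply; exists G.
Qed.

Lemma ramsey_le {r k} {G H : kgraph k} : arrows r G H -> ramsey r H <= #|G|.
Proof.
move=> aG; have [_] := leastP
  (P := fun m => exists G : kgraph k, arrows r G H /\ #|G| = m)
  (ex_intro _ G (conj aG erefl)).
by apply; exists G.
Qed.

Lemma not_arrows {r k} {G H : kgraph k} : ~ arrows r G H ->
  exists col : {set G} -> 'I_r, forall c (f : H -> G), injective f ->
    ~ (forall e, e \in edges H -> f @: e \in edges G /\ col (f @: e) = c).
Proof.
move=> /existsNP[col Hcol]; exists col => c f inj_f Hf.
by apply: Hcol; exists c, f.
Qed.

(** * Greedy vertex colouring *)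

Lemma greedy_coloring (T : finType) (e : rel T) m (A : {set T}) :
  symmetric e -> (forall x, x \in A -> #|[set y | e x y]| < m) ->
  exists cl : T -> nat, (forall x, x \in A -> cl x < m) /\
    {in A &, forall x y, e x y -> x != y -> cl x != cl y}.
Proof.
move=> e_sym; move: {2}#|A| (erefl #|A|) => a.
elim: a A => [|a IHa] A cA degA.
  have -> : A = set0 by apply/eqP; rewrite -cards_eq0 cA.
  by exists (fun=> 0); split=> [x|x y]; rewrite inE.
have /card_gt0P[x xA] : 0 < #|A| by rewrite cA.
have [||cl [lt_cl cl_ok]] := IHa (A :\ x).
- by move: cA; rewrite (cardsD1 x) xA; case.
- by move=> y /setD1P[_ /degA].
(* Fewer than [m] neighbours cannot occupy all [m] classes. *)
have [i lt_i free_i] : exists2 i, i < m & forall y, e x y -> cl y != i.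
  apply: contrapT => no.
  have /subset_leq_card : [set: 'I_m] \subset
      [set i : 'I_m | [exists y in [set y | e x y], cl y == i]].
    apply/subsetP => i _; rewrite inE; apply: contraT => Hi; case: no.
    exists (val i) => [|y exy]; first exact: ltn_ord.
    apply: contra Hi => cy.
    by apply/existsP; exists y; rewrite inE exy.
  rewrite cardsT card_ord leqNgt => /negP; apply.
  apply: leq_ltn_trans (degA x xA).
  have m_gt0 : 0 < m by apply: leq_ltn_trans (degA x xA).
  case: m m_gt0 no degA {lt_cl IHa} => // m _ _ _.
  apply: leq_trans (leq_imset_card (fun y => inord (cl y) : 'I_m.+1) _).
  apply/subset_leq_card/subsetP => j; rewrite inE => /existsP[y /andP[ey /eqP ej]].
  by apply/imsetP; exists y => //; apply: val_inj; rewrite /= inordK ej.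
exists (fun y => if y == x then i else cl y); split.
  by move=> y yA; case: eqVneq => // yx; apply: lt_cl; rewrite !inE yx.
move=> y z yA zA eyz yz.
case: (eqVneq y x) => yx; case: (eqVneq z x) => zx.
- by rewrite yx zx eqxx in yz.
- by rewrite eq_sym free_i // -yx.
- by rewrite free_i // -zx e_sym.
- by apply: cl_ok; rewrite ?inE ?yx ?zx.
Qed.

(** * Degrees, links and low vertices *)

Definition deg {k} (G : kgraph k) (v : G) : nat :=
  #|[set e in edges G | v \in e]|.

Definition link_edges {k} (G : kgraph k) (v : G) : {set {set G}} :=
  [set e :\ v | e in [set e in edges G | v \in e]].

Lemma link_edges_card {k} (G : kgraph k) (v : G) e :
  e \in link_edges G v -> #|e| = k - 1.
Proof.
case/imsetP => e'; rewrite inE => /andP[/edges_card ck ve] ->.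
by move: ck; rewrite (cardsD1 v) ve => /(canRL (addKn 1)).
Qed.

(** The link keeps all vertices of [G], with [v] isolated, so that copies in the link and in [G]
    share one vertex type. *)
Definition link {k} (G : kgraph k) (v : G) : kgraph (k - 1) :=
  KGraph (link_edges_card G v).

Lemma sum_deg k (G : kgraph k) : \sum_(v : G) deg G v = k * #|edges G|.
Proof.
have E v : deg G v = \sum_(e in edges G) (v \in e).
  by rewrite /deg -sum1dep_card big_mkcondr.
under eq_bigr do rewrite E.
rewrite exchange_big /= (eq_bigr (fun=> k)).
  by rewrite sum_nat_const mulnC.
by move=> e /edges_card; rewrite -sum1_card big_mkcond.
Qed.

Definition low {k} (G : kgraph k) s : {set G} := [set v | deg G v < s].

Definition adj {k} (G : kgraph k) : rel G :=
  fun u v => (u != v) && [exists e in edges G, (u \in e) && (v \in e)].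

Lemma adj_sym k (G : kgraph k) : symmetric (adj G).
Proof.
move=> u v; rewrite /adj eq_sym; congr (_ && _).
by apply: eq_existsb => e; rewrite [(u \in e) && _]andbC.
Qed.

Lemma card_adj k (G : kgraph k) (v : G) :
  #|[set u | adj G v u]| <= deg G v * (k - 1).
Proof.
have sub : [set u | adj G v u] \subset
    \bigcup_(e in [set e in edges G | v \in e]) (e :\ v).
  apply/subsetP => u; rewrite inE => /andP[vu /existsP[e /and3P[Ge ve ue]]].
  by apply/bigcupP; exists e; rewrite !inE ?Ge ?ve // eq_sym vu.
apply: leq_trans (subset_leq_card sub) _.
rewrite /deg -sum_nat_const.
apply: (big_ind2 (fun (A : {set G}) n => #|A| <= n)); first by rewrite cards0.
  move=> A n B m An Bm; apply: leq_trans (leq_add An Bm).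
  by rewrite cardsU leq_subr.
move=> e He; rewrite (link_edges_card G v) //.
by apply/imsetP; exists e.
Qed.

(** * Edges of overlapping paths and links of path vertices *)

Lemma path_edge_in k l n i : i < (n - l) %/ (k - l) ->
  path_edge k l n i \in edges (opath k l n).
Proof. by move=> lt_i; apply/imsetP; exists (Ordinal lt_i). Qed.

Lemma path_edge_le k l n i : l < k -> i < (n - l) %/ (k - l) ->
  i.+1 * (k - l) + l <= n.
Proof.
move=> lt_lk; rewrite leq_divRL ?subn_gt0 // => le_i.
(* Positivity rules out that [n - l] was truncated to 0. *)
have : 0 < i.+1 * (k - l) by rewrite muln_gt0 subn_gt0.
lia.
Qed.

Lemma path_edge_lt k l n i : l < k -> i.+1 * (k - l) + l <= n ->
  i < (n - l) %/ (k - l).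
Proof. by move=> lt_lk le_n; rewrite leq_divRL ?subn_gt0 //; lia. Qed.

(** [bump h] is the increasing map that skips [h]: deleting [h] from a window and closing the gap
    shortens the window by one. *)
Lemma bump_window a m h x : a <= h < a + m ->
  (a <= bump h x < a + m) = (a <= x < a + (m - 1)).
Proof. by rewrite /bump; case: (leqP h x) => /=; lia. Qed.

(* The [k %/ (k - l)] edges of [P_n^(k,l)] ending with the one numbered
   [p %/ (k - l)] all contain [p]; removing [p] from them leaves a
   [(k - 1, l - 1)]-path on [link_order k l] vertices. *)
Lemma link_opath k l n (p : 'I_n) j : 0 < l < k ->
  j + k %/ (k - l) = (p %/ (k - l)).+1 -> p %/ (k - l) < (n - l) %/ (k - l) ->
  exists2 h : 'I_(link_order k l) -> 'I_n, injective h &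
    forall i, i < (link_order k l - (l - 1)) %/ (k - 1 - (l - 1)) ->
      [/\ j + i < (n - l) %/ (k - l), p \in path_edge k l n (j + i) &
          h @: path_edge (k - 1) (l - 1) _ i = path_edge k l n (j + i) :\ p].
Proof.
move=> /andP[l_gt0 lt_lk] jE lt_p.
have dE : k - 1 - (l - 1) = k - l by clear -l_gt0 lt_lk; lia.
rewrite dE /link_order addKn mulnK ?subn_gt0 //.
have d_gt0 : 0 < k - l by rewrite subn_gt0.
have kE : k = (k - l) + l by rewrite subnK // ltnW.
have t_gt0 : 0 < k %/ (k - l) by rewrite divn_gt0 // leq_subr.
have le_n : (p %/ (k - l)).+1 * (k - l) + l <= n by apply: path_edge_le.
have le_td : k %/ (k - l) * (k - l) <= k by apply: leq_divM.
have nE i : path_edge k l n i = [set v : 'I_n | i * (k - l) <= v < i * (k - l) + k] by [].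
have qE i q : path_edge (k - 1) (l - 1) q i =
    [set v : 'I_q | i * (k - l) <= v < i * (k - l) + (k - 1)].
  by rewrite /path_edge dE.
move: (k - l) (k %/ (k - l)) => d t in dE kE le_td jE lt_p d_gt0 t_gt0 le_n nE qE *.
have jdE : j * d + t * d = (p %/ d).+1 * d by rewrite -mulnDl jE.
have lt_pd : p < (p %/ d).+1 * d by apply: ltn_ceil.
rewrite -jdE in le_n lt_pd.
have le_jt : (j + t.-1) * d <= p.
  by apply: leq_trans (leq_divM p d); rewrite leq_mul2r; lia.
(* The last of the [t] edges starts no later than [p], and the first still reaches [p] because
   [t * d <= k]. *)
have le_jp i : i < t -> (j + i) * d <= p < (j + i) * d + k.
  move=> lt_it; apply/andP; split.
    by apply: leq_trans le_jt; rewrite leq_mul2r; lia.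
  have : j * d <= (j + i) * d by rewrite leq_mul2r leq_addr orbT.
  lia.
have j_le : j * d <= p by have := le_jp 0 t_gt0; rewrite addn0 => /andP[].
(* The [t] edges span [l + t * d] positions from [j * d] on; the embedding runs through them in
   order and skips [p]. *)
have lt_h (x : 'I_(l - 1 + t * d)) : j * d + bump (p - j * d) x < n.
  case: x => x /= lt_x; rewrite /bump; move: (p - _ <= x) lt_x le_n.
  by move: (j * d) (t * d) => J Q c; clear -l_gt0; case: c => /=; lia.
exists (fun x => Ordinal (lt_h x)) => [x y /(congr1 val) /= /addnI|i lt_it].
  by move=> /(can_inj (bumpK _)) /val_inj.
have /andP[le1 lt2] := le_jp i lt_it.
split; [by lia|by rewrite nE inE le1|].
have le_it : i * d + (k - 1) <= l - 1 + t * d.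
  have : i.+1 * d <= t * d by rewrite leq_mul2r lt_it orbT.
  by rewrite mulSn; move: (i * d) (t * d) => I Q; clear -kE l_gt0; lia.
have p_in : i * d <= p - j * d < i * d + k.
  by rewrite -(leq_add2l (j * d)) -(ltn_add2l (j * d)) subnKC // addnA -mulnDl le1.
rewrite nE qE; apply/setP => y; rewrite !inE mulnDl -addnA; apply/imsetP/andP => [[x]|].
  rewrite inE -(bump_window _ _ _ _ p_in) => /andP[x1 x2] ->.
  rewrite -(inj_eq val_inj) /= leq_add2l ltn_add2l x1 x2; split=> //.
  by rewrite -[X in _ != X](subnKC j_le) eqn_add2l eq_sym neq_bump.
case=> yp /andP[y1 y2].
have le_jy : j * d <= y := leq_trans (leq_addr _ _) y1.
rewrite -(subnKC le_jy) leq_add2l ltn_add2l in y1 y2.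
have /unbumpK yK : y - j * d \in predC1 (p - j * d).
  by rewrite inE -(eqn_add2l (j * d)) !subnKC.
have := bump_window _ _ _ (unbump (p - j * d) (y - j * d)) p_in.
rewrite yK y1 y2 => /esym/andP[x1 x2].
exists (Ordinal (leq_trans x2 le_it)); first by rewrite inE /= x1.
by apply: val_inj; rewrite /= yK subnKC.
Qed.

(** * Low vertices on a monochromatic path *)

(* The vertices of class 0 are not interior to a monochromatic path, since
   their links are coloured without a monochromatic [P_q]. A vertex of class
   [a] behaves in the same way unless some edge through it meets a smaller
   class, and then it is within [k - 1] of a vertex which is itself near an
   end of the path. *)
Lemma low_near_ends r k l n (G : kgraph k) (A : {set G}) (cl : G -> nat)
    (cv : G -> {set G} -> 'I_r) (phi : {set G} -> 'I_r) c
    (f : opath k l n -> G) :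
  0 < l < k ->
  (forall v, v \in A -> forall c (g : opath (k - 1) (l - 1) (link_order k l) -> link G v),
    injective g -> ~ (forall e, e \in edges (opath (k - 1) (l - 1) (link_order k l)) ->
      g @: e \in edges (link G v) /\ cv v (g @: e) = c)) ->
  (forall e u v, e \in edges G -> u \in e -> v \in e -> u \in A -> v \in A ->
    u != v -> cl u != cl v) ->
  (forall e v, e \in edges G -> v \in e -> v \in A ->
    (forall u, u \in e -> u \in A -> cl v <= cl u) -> phi e = cv v (e :\ v)) ->
  injective f ->
  (forall e, e \in edges (opath k l n) -> f @: e \in edges G /\ phi (f @: e) = c) ->
  forall p : 'I_n, f p \in A ->
    p < (cl (f p)).+1 * (k - 1) \/ n <= p + (cl (f p)).+1 * (k - 1).
Proof.
move=> lk cvP cl_ok phiP inj_f fP p; have /andP[l_gt0 lt_lk] := lk.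
move: {2}(cl _) (erefl (cl (f p))) => a.
elim/ltn_ind: a p => a IHa p cla fpA; rewrite cla mulSn.
apply: contrapT => /not_orP[/negP]; rewrite -leqNgt => p_ge /negP.
rewrite -ltnNge => p_lt.
have d_gt0 : 0 < k - l by rewrite subn_gt0.
have t_gt0 : 0 < k %/ (k - l) by rewrite divn_gt0 // leq_subr.
have le_pd := leq_divM p (k - l).
(* Distance from the right end makes the edge numbered [p %/ (k - l)] exist; distance from the left
   end leaves room for all [k %/ (k - l)] edges ending with it. *)
have lt_p : p %/ (k - l) < (n - l) %/ (k - l).
  apply: path_edge_lt => //; rewrite mulSn addnAC subnK ?(ltnW lt_lk) //.
  move: (_ %/ _ * _) (a * _) le_pd p_lt => x y le_pd p_lt. lia.
have le_p : k %/ (k - l) <= (p %/ (k - l)).+1.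
  rewrite -[leqLHS]prednK // ltnS leq_divRL //.
  apply: leq_trans p_ge; apply: leq_trans (leq_addr _ _).
  move: (k - l) d_gt0 t_gt0 => d d_gt0 t_gt0.
  have := leq_divM k d; rewrite -[X in X * _ <= _]prednK // mulSn.
  by move: (_ * d) => x; clear -d_gt0; lia.
have [h inj_h hP] := link_opath _ _ _ p _ lk (subnK le_p) lt_p.
apply: (cvP (f p) fpA c (f \o h)); first exact: inj_comp.
move=> _ /imsetP[[i /= lt_i] _ ->]; have [lt_j p_in hE] := hP i lt_i.
rewrite imset_comp hE; set e := path_edge _ _ _ _ in p_in *.
have -> : f @: (e :\ p) = f @: e :\ f p.
  apply/setP => y; rewrite in_setD1; apply/imsetP/andP.
    case=> x /setD1P[xp xe] ->.
    by rewrite (inj_eq inj_f) xp; split=> //; apply: imset_f.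
  case=> yp /imsetP[x xe yx]; exists x => //.
  by rewrite in_setD1 xe andbT -(inj_eq inj_f) -yx.
have [Ge phie] := fP e (path_edge_in _ _ _ _ lt_j).
have fpe : f p \in f @: e by apply: imset_f.
split; first by apply/imsetP; exists (f @: e) => //; rewrite inE Ge.
rewrite -phie; apply/esym/phiP => // _ /imsetP[y ye ->] fyA.
rewrite leqNgt; apply/negP; rewrite cla => lt_a.
have := IHa _ lt_a y erefl fyA.
have : (cl (f y)).+1 * (k - 1) <= a * (k - 1) by rewrite leq_mul2r lt_a orbT.
move: p_ge p_lt ye p_in; rewrite !inE.
move: ((_ + _) * (k - l)) (_.+1 * _) (a * _) => I U W.
move: (nat_of_ord y) (nat_of_ord p) => x z; clear -lt_lk; lia.
Qed.

(** A low vertex lies in at most [s - 1] edges, so it has at most [(s - 1) * (k - 1)] neighbours,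
    fewer than there are classes. *)
Lemma low_vertices_coloring k (G : kgraph k) s : 0 < s -> 1 < k ->
  exists cl : G -> nat, (forall v, v \in low G s -> cl v < s * (k - 1)) /\
    (forall e u v, e \in edges G -> u \in e -> v \in e ->
      u \in low G s -> v \in low G s -> u != v -> cl u != cl v).
Proof.
move=> s_gt0 k_gt1.
have [v|cl [lt_cl cl_ok]] :=
  greedy_coloring _ (adj G) (s * (k - 1)) (low G s) (adj_sym k G).
  rewrite inE => lt_s; apply: leq_ltn_trans (card_adj _ _ _) _.
  by rewrite ltn_mul2r lt_s andbT; lia.
exists cl; split=> // e u v Ge ue ve uA vA uv; apply: cl_ok => //.
by rewrite /adj uv; apply/existsP; exists e; rewrite Ge ue.
Qed.

(** * The colouring without a monochromatic path *)

Lemma not_arrows_few_high r k l n (G : kgraph k)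
    (s := size_ramsey r (opath (k - 1) (l - 1) (link_order k l))) :
  0 < l < k -> 0 < s -> #|~: low G s| < ramsey r (opath k l (n - c0 r k l)) ->
  c0 r k l <= n -> ~ arrows r G (opath k l n).
Proof.
move=> lk s_gt0 lt_high le_n; have /andP[l_gt0 lt_lk] := lk.
set B := ~: low G s in lt_high.
have [colB HB] : exists colB : {set {x | x \in B}} -> 'I_r,
    forall c (f : opath k l (n - c0 r k l) -> {x | x \in B}), injective f ->
    ~ (forall e, e \in edges (opath k l (n - c0 r k l)) -> colB (f @: e) = c).
  have /not_arrows[col colP] :
      ~ arrows r (complete k {x | x \in B}) (opath k l (n - c0 r k l)).
    by move=> /ramsey_le; rewrite /= card_sig leqNgt => /negP.
  exists col => c f inj_f fP; apply: (colP c f inj_f) => e He.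
  by rewrite inE card_imset // edges_card // eqxx fP.
have i0 : 'I_r by exact: colB set0.
have [cv cvP] : {cv : G -> {set G} -> 'I_r & forall v, v \in low G s ->
    forall c (g : opath (k - 1) (l - 1) (link_order k l) -> link G v),
    injective g -> ~ (forall e, e \in edges (opath (k - 1) (l - 1) (link_order k l)) ->
      g @: e \in edges (link G v) /\ cv v (g @: e) = c)}.
  apply: (choice (P := fun v (cv : {set G} -> 'I_r) => v \in low G s -> forall c g,
    injective g -> ~ (forall e, e \in edges (opath (k - 1) (l - 1) (link_order k l)) ->
      g @: e \in edges (link G v) /\ cv (g @: e) = c))) => v.
  have [|vA] := boolP (v \in low G s); last by exists (fun=> i0).
  rewrite inE => lt_s.
  suff /not_arrows[col colP] : ~ arrows r (link G v) (opath (k - 1) (l - 1) (link_order k l)).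
    by exists col => _; apply: colP.
  move=> /size_ramsey_le; rewrite leqNgt => /negP; apply.
  by apply: leq_ltn_trans lt_s; apply: leq_imset_card.
have [|cl [lt_cl cl_ok]] := low_vertices_coloring k G s s_gt0; first by lia.
(* An edge meets each class at most once, so the picked vertex is unique and [phi_low] determines
   the colour. *)
pose phi (e : {set G}) : 'I_r :=
  if [pick v in e | (v \in low G s) &&
        [forall u in e, (u \in low G s) ==> (cl v <= cl u)]] is Some v
  then cv v (e :\ v) else colB (val @^-1: e).
have phi_low e v : e \in edges G -> v \in e -> v \in low G s ->
    (forall u, u \in e -> u \in low G s -> cl v <= cl u) -> phi e = cv v (e :\ v).
  move=> Ge ve vA v_min; rewrite /phi; case: pickP => [w|/(_ v)].
    case/and3P=> we wA /forall_inP w_min; case: (eqVneq w v) => [->//|wv].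
    have /negP[] := cl_ok e w v Ge we ve wA vA wv.
    by rewrite eqn_leq v_min // andbT (implyP (w_min v ve)).
  rewrite ve vA /= => /negP[]; apply/forall_inP => u ue; apply/implyP => uA.
  exact: v_min.
have phi_high (D : {set {x | x \in B}}) : phi (val @: D) = colB D.
  rewrite /phi; case: pickP => [v|_].
    case/and3P => /imsetP[x _ ->] /=; have := valP x.
    by rewrite inE => /negPf ->.
  by congr colB; apply/setP => y; rewrite inE mem_imset //; apply: val_inj.
move=> /(_ phi)[c [f [inj_f fP]]].
have near := low_near_ends r k l n G _ cl cv phi c f lk cvP cl_ok phi_low inj_f fP.
(* Classes are below [s * (k - 1)], so [w] bounds the distance of low vertices from the ends. The
   first [j] steps are cut off, a whole number of steps so that edges shift to edges. *)
pose w := s * (k - 1) * (k - 1); pose j := (w %/ (k - l)).+1.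
have d_gt0 : 0 < k - l by rewrite subn_gt0.
have w_le : w <= j * (k - l) by apply/ltnW/ltn_ceil.
(* Rounding up to whole steps costs at most [k - l <= k - 1], so both ends together lose at most
   [2 * w + (k - 1)], which the factor [2 * k ^ 2] covers. *)
have j_le : j * (k - l) + w <= c0 r k l.
  have := leq_divM w (k - l); rewrite /j /c0 -/s mulSn.
  have : w + (k - 1) <= k ^ 2 * s.
    rewrite /w; have [k' ->] : exists k', k = k'.+1 by exists k.-1; lia.
    rewrite subn1 /= expnS expn1; nia.
  lia.
have lt_x (x : 'I_(n - c0 r k l)) : j * (k - l) + x < n by have := ltn_ord x; lia.
have inB (x : 'I_(n - c0 r k l)) : f (Ordinal (lt_x x)) \in B.
  rewrite inE; apply/negP => fA; have := near _ fA.
  have := lt_cl _ fA; move: (cl _) => a lt_a.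
  have : a.+1 * (k - 1) <= w by rewrite leq_mul2r lt_a orbT.
  move: (a.+1 * _) (ltn_ord x) => b /=; move: (nat_of_ord x) => y.
  by move: (j * _) (w) (c0 r k l) w_le j_le le_n => J W C; clear; lia.
apply: (HB c (fun x => Sub (f (Ordinal (lt_x x))) (inB x))) => [x y|].
  by move=> /(congr1 val) /= /inj_f /(congr1 val) /= /addnI /val_inj.
move=> _ /imsetP[[i /= lt_i] _ ->]; rewrite -phi_high -imset_comp.
have le_i := path_edge_le _ _ _ _ lt_lk lt_i.
have lt_ji : j + i < (n - l) %/ (k - l).
  apply: path_edge_lt => //; rewrite -addnS mulnDl -addnA.
  apply: leq_trans (leq_add (leq_trans (leq_addr w _) j_le) le_i) _.
  by rewrite subnKC.
have [_ <-] := fP _ (path_edge_in _ _ _ _ lt_ji); congr phi.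
rewrite mulSn addnAC subnK ?(ltnW lt_lk) // addnC in le_i.
apply/setP => y; apply/imsetP/imsetP => -[x].
  rewrite inE => /andP[x1 x2] ->; exists (Ordinal (lt_x x)) => //.
  by rewrite inE /= mulnDl -addnA ltn_add2l leq_add2l x1.
rewrite inE mulnDl -addnA => /andP[x1 x2] ->.
have le_x : j * (k - l) <= x by apply: leq_trans x1; apply: leq_addr.
rewrite -(subnKC le_x) leq_add2l ltn_add2l in x1 x2.
exists (Ordinal (leq_trans x2 le_i)); first by rewrite inE /= x1.
by rewrite /=; congr f; apply: val_inj; rewrite /= subnKC.
Qed.

(** * Degree counting and the lower bound *)

Lemma size_ramsey_opath_ge r k l n : 0 < l < k -> c0 r k l <= n ->
  size_ramsey r (opath (k - 1) (l - 1) (link_order k l))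
    * ramsey r (opath k l (n - c0 r k l)) <= k * size_ramsey r (opath k l n).
Proof.
move=> lk le_n; set s := size_ramsey _ _.
have [-> //|s_gt0] := posnP s.
have [G aG <-] := size_ramseyP r k (opath k l n).
rewrite -sum_deg; apply: leq_trans (_ : #|~: low G s| * s <= _).
  rewrite mulnC leq_mul2r leqNgt.
  apply/orP; right; apply/negP => lt_high.
  exact: not_arrows_few_high lk s_gt0 lt_high le_n aG.
rewrite -sum_nat_const big_mkcond leq_sum // => v _.
by rewrite !inE -leqNgt; case: ifP.
Qed.

Local Open Scope ring_scope.

Theorem theorem1p2 (r k l n : nat) (hr : (2 <= r)%N) (hk : (2 <= k)%N)
    (hl : (1 <= l <= k - 1)%N) (hn : (c0 r k l <= n)%N) :
  ((size_ramsey r (opath k l n))%:R : rat) >=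
    1 / k%:R
    * (size_ramsey r (opath (k - 1) (l - 1) (link_order k l)))%:R
    * (ramsey r (opath k l (n - c0 r k l)))%:R
  /\
  (l = (k - 1)%N ->
   ((size_ramsey r (tight_path k n))%:R : rat) >=
     1 / k%:R
     * (size_ramsey r (tight_path (k - 1) (2 * k - 2)))%:R
     * (ramsey r (tight_path k (n - c0 r k l)))%:R).
Proof.
set P := (X in X /\ _); have HP : P.
  rewrite /P div1r -mulrA ler_pdivrMl ?ltr0n; last by lia.
  rewrite -!natrM ler_nat; apply: size_ramsey_opath_ge => //; lia.
split=> // lE; move: HP; rewrite /P /tight_path.
(* Here [k - l = 1], so the order is [(k - 2) + k]. *)
have -> : link_order k l = (2 * k - 2)%N.
  by rewrite /link_order lE subKn ?divn1 ?muln1; lia.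
by rewrite lE.
Qed.
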